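(* For every $n\ge 3$, the network realignment complex $X_n$ is a cubical flag complex.
   Context: A network realignment $N=(T,r)$ over the complete graph $K_n$ with vertex set $[n]=\{1,\dots,n\}$ consists of a partition $[n]=A\sqcup B$ with $|A|\ge 2$ ($B$ may be empty), a tree $T$ with vertex set $A$, and a map $r\colon B\to E(T)$. For $b\in B$ and an endpoint $v$ of $r(b)$, the specification $N^{b\to v}$ is the network realignment with partition $A\cup\{b\}$, $B\setminus\{b\}$, tree obtained from $T$ by adding the vertex $b$ and the edge $(v,b)$, and map $r|_{B\setminus\{b\}}$. The network realignment complex $X_n=X_{K_n}$ is the finite cubical complex whose face poset is the set of all network realignments over $K_n$ with partial order generated by $N\succ N^{b\to v}$; the cell indexed by $N$ is a cube of dimension $|B|$. Let $I^k$ be the $k$-cube and $(I^k)_1$ its 1-skeleton. A cubical complex $K$ is called a cubical flag complex (or determined by its 1-skeleton) if for all $k\ge 2$ every injective cellular map $(I^k)_1\to K$ admits a unique extension $I^k\to K$ (here cellular maps are maps of cubical complexes, sending each cube isomorphically onto a cube). *)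

(* Defs.v *)
From HB Require Import structures.
From mathcomp Require Import all_boot all_order.

Set Implicit Arguments.
Unset Strict Implicit.
Unset Printing Implicit Defensive.

Import Order.TTheory.
Local Open Scope order_scope.

(* A finite cubical complex is given by its face poset (nonempty cells ordered
   by inclusion): a finite poset in which every principal ideal is isomorphic
   to the face poset of a cube.  Maps that send each cube isomorphically onto
   a cube are given by their action on cells. *)

(* A nonempty face of I^k = [0,1]^k is a product of k factors among the
   endpoints [Some false], [Some true] and the whole interval [None]. *)
Definition cube (k : nat) : Type := {ffun 'I_k -> option bool}.

HB.instance Definition _ k := Finite.on (cube k).

Definition cube_le k (c d : cube k) : bool :=
  [forall i, (d i == None) || (c i == d i)].

Fact cube_le_refl k : reflexive (@cube_le k).
Proof. by move=> c; apply/forallP => i; rewrite eqxx orbT. Qed.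

Fact cube_le_anti k : antisymmetric (@cube_le k).
Proof.
move=> c d /andP[/forallP h1 /forallP h2]; apply/ffunP => i.
by case/orP: (h1 i) (h2 i) => [/eqP->|/eqP->] // /orP[]/eqP->.
Qed.

Fact cube_le_trans k : transitive (@cube_le k).
Proof.
move=> d c e /forallP h1 /forallP h2; apply/forallP => i.
case/orP: (h2 i) => [->//|/eqP<-]; exact: h1.
Qed.

Fact cube_display : Order.disp_t. Proof. exact: (Order.Disp tt tt). Qed.

HB.instance Definition _ k :=
  Order.Le_isPOrder.Build cube_display (cube k)
    (@cube_le_refl k) (@cube_le_anti k) (@cube_le_trans k).

Lemma cubeP k (c d : cube k) :
  reflect (forall i, d i = None \/ c i = d i) (c <= d).
Proof.
apply: (iffP forallP) => h i.
  by case/orP: (h i) => /eqP ->; [left | right].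
by case: (h i) => ->; rewrite eqxx // orbT.
Qed.

HB.mixin Record isCubical (d : Order.disp_t) T of Order.FinPOrder d T := {
  cdim : T -> nat;
  cubical_chart : forall x : T, exists2 phi : cube (cdim x) -> T,
    {mono phi : c c' / c <= c'} & forall y, (y <= x) = (y \in codom phi)
}.

#[short(type="cubicalType")]
HB.structure Definition Cubical (d : Order.disp_t) :=
  { T of isCubical d T & Order.FinPOrder d T }.

(* [pull S c] extends by [None] a function on the indices of the elements
   of [S]. *)
Definition pull (I : finType) (S : {set I}) (T : Type)
    (c : 'I_#|S| -> option T) (i : I) : option T :=
  if insub (index i (enum S)) is Some j then c j else None.

Lemma pull_val (I : finType) (S : {set I}) T (c : 'I_#|S| -> option T) j :
  pull c (enum_val j) = c j.
Proof.
rewrite /pull /enum_val index_uniq ?enum_uniq -?cardE //.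
by rewrite valK.
Qed.

Lemma pull_out (I : finType) (S : {set I}) T (c : 'I_#|S| -> option T) i :
  i \notin S -> pull c i = None.
Proof.
move=> iS; rewrite /pull insubF //; apply/negbTE.
by rewrite cardE index_mem mem_enum.
Qed.

Lemma enum_val_ex (I : finType) (S : {set I}) i :
  i \in S -> exists j : 'I_#|S|, i = enum_val j.
Proof. by move=> iS; exists (enum_rank_in iS i); rewrite enum_rankK_in. Qed.

Definition cube_dim k (c : cube k) : nat := #|[set i | c i == None]|.

Fact cube_chart k (c : cube k) : exists2 phi : cube (cube_dim c) -> cube k,
  {mono phi : d d' / d <= d'} & forall y, (y <= c) = (y \in codom phi).
Proof.
pose phi (d : cube (cube_dim c)) : cube k :=
  [ffun i => if c i is Some s then Some s else pull d i].
have phiE d j : phi d (enum_val j) = d j.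
  rewrite ffunE; have := enum_valP j; rewrite inE => /eqP->.
  exact: pull_val.
exists phi.
  move=> d d'; apply/cubeP/cubeP => h.
    by move=> j; have := h (enum_val j); rewrite !phiE.
  move=> i; case ci: (c i) => [s|]; first by right; rewrite !ffunE ci.
  have [|j ->] := @enum_val_ex _ [set i | c i == None] i; first by rewrite inE ci.
  by rewrite !phiE.
move=> y; apply/cubeP/codomP => [h|[d ->] i]; last first.
  by rewrite ffunE; case: (c i) => [s|]; [right | left].
exists [ffun j => y (enum_val j)]; apply/ffunP => i.
case ci: (c i) => [s|]; first by rewrite ffunE ci; have := h i; rewrite ci; case.
have [|j ->] := @enum_val_ex _ [set i | c i == None] i; first by rewrite inE ci.
by rewrite phiE ffunE.
Qed.

HB.instance Definition _ k :=
  isCubical.Build cube_display (cube k) (@cube_chart k).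

Lemma card_cube k : #|{: cube k}| = (3 ^ k)%N.
Proof. by rewrite /cube card_ffun card_option card_bool card_ord. Qed.

Lemma card_ideal d (K : cubicalType d) (x : K) :
  #|[pred y : K | y <= x]| = (3 ^ cdim x)%N.
Proof.
have [phi mphi imphi] := cubical_chart x.
rewrite -card_cube -(card_codom (inc_inj mphi)).
by apply: eq_card => y; rewrite inE imphi.
Qed.

Lemma leq_cdim d (K : cubicalType d) (x y : K) :
  y <= x -> (cdim y <= cdim x)%N.
Proof.
move=> yx; rewrite -(@leq_exp2l 3) // -!card_ideal; apply: subset_leq_card.
by apply/subsetP => z; rewrite !inE => /le_trans; apply.
Qed.

Definition skeleton (m : nat) d (K : cubicalType d) : Type :=
  {x : K | (cdim x <= m)%N}.

HB.instance Definition _ m d (K : cubicalType d) := SubType.on (skeleton m K).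
HB.instance Definition _ m d (K : cubicalType d) := Finite.on (skeleton m K).
HB.instance Definition _ m d (K : cubicalType d) :=
  [SubChoice_isSubPOrder of skeleton m K by <: with d].

Fact skeleton_chart m d (K : cubicalType d) (x : skeleton m K) :
  exists2 phi : cube (cdim (val x)) -> skeleton m K,
    {mono phi : c c' / c <= c'} & forall y, (y <= x) = (y \in codom phi).
Proof.
have [phi mphi imphi] := cubical_chart (val x).
have phix c : phi c <= val x by rewrite imphi codom_f.
have phim c : (cdim (phi c) <= m)%N by exact: leq_trans (leq_cdim _) (valP x).
exists (fun c => Sub (phi c) (phim c)).
  by move=> c c'; rewrite -(mphi c c') -Order.le_val /=.
move=> y; rewrite -Order.le_val imphi; apply/codomP/codomP => -[c yc]; exists c.
  by apply: val_inj; rewrite SubK.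
by rewrite yc SubK.
Qed.

HB.instance Definition _ m d (K : cubicalType d) :=
  isCubical.Build d (skeleton m K) (@skeleton_chart m d K).

(* [f] restricts, for every cell [x], to an isomorphism from the faces of [x]
   onto the faces of [f x]. *)
Definition cellular d d' (K : cubicalType d) (L : cubicalType d') (f : K -> L) :=
  forall x : K,
    {in [pred y | y <= x] &, {mono f : y z / y <= z}} /\
    (forall w : L, w <= f x -> exists2 y : K, y <= x & f y = w).

Definition cellular_extension d (K : cubicalType d) m k
    (f : skeleton m (cube k) -> K) (g : cube k -> K) :=
  cellular g /\ forall x : skeleton m (cube k), g (val x) = f x.

Definition cubical_flag d (K : cubicalType d) :=
  forall (k : nat) (f : skeleton 1 (cube k) -> K),
    (2 <= k)%N -> injective f -> cellular f ->
    exists2 g : cube k -> K, cellular_extension f g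
      & forall g' : cube k -> K, cellular_extension f g' -> g' =1 g.

Section Trees.
Variable V : finType.
Implicit Types (A e : {set V}) (E : {set {set V}}).

Definition adj E : rel V := fun x y => [set x; y] \in E.

Definition acyclic E : bool :=
  [forall k : 'I_#|V|.+1, forall t : k.-tuple V,
     (2 < k)%N ==> ~~ ucycleb (adj E) t].

Definition is_tree A E : bool :=
  [&& [forall e in E, (e \subset A) && (#|e| == 2)],
      [forall x in A, forall y in A, connect (adj E) x y]
    & acyclic E].

Lemma acyclicP E :
  reflect (forall s, ucycle (adj E) s -> (size s <= 2)%N) (acyclic E).
Proof.
apply: (iffP forallP) => [h s /andP[cs us]|h k].
  rewrite leqNgt; apply/negP => s2.
  have sV : (size s < #|V|.+1)%N by rewrite ltnS -(card_uniqP us) max_card.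
  have /forallP/(_ (in_tuple s)) := h (Ordinal sV).
  by rewrite /= s2 /ucycleb /= cs us.
apply/forallP => t; apply/implyP => k2; apply/negP => /h.
by rewrite size_tuple leqNgt k2.
Qed.

Lemma tree_edge A E e : is_tree A E -> e \in E -> (e \subset A) /\ #|e| = 2.
Proof. by case/and3P=> /forall_inP h _ _ /h /andP[? /eqP]. Qed.

Lemma tree_connect A E :
  is_tree A E -> {in A &, forall x y, connect (adj E) x y}.
Proof. by case/and3P=> _ /forall_inP h _ x y /h /forall_inP; apply. Qed.

Lemma adj_sym E : symmetric (adj E).
Proof. by move=> x y; rewrite /adj setUC. Qed.

Lemma tree_leaf A E v b :
  v \in A -> b \notin A -> is_tree A E -> is_tree (b |: A) ([set v; b] |: E).
Proof.
move=> vA bA tr; set E' := _ |: E.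
have vb : v != b by apply: contraNneq bA => <-.
have sE : subrel (connect (adj E)) (connect (adj E')).
  by apply: connect_sub => x y xy; apply: connect1; rewrite /adj /E' inE [_ \in E]xy orbT.
have cvb : connect (adj E') v b by apply: connect1; rewrite /adj !inE eqxx.
have csym : connect_sym (adj E') by apply/sym_connect_sym/adj_sym.
have adjb x : adj E' b x -> x = v.
  rewrite /adj !inE => /orP[/eqP eq2|/(tree_edge tr)[/subsetP/(_ b)]]; last first.
    by rewrite !inE eqxx (negbTE bA) => /(_ isT).
  have : v \in [set b; x] by rewrite eq2 !inE eqxx.
  by rewrite !inE (negbTE vb) => /eqP.
apply/and3P; split.
- apply/forall_inP => e; rewrite !inE => /orP[/eqP->|/(tree_edge tr)[eA ->]].
    rewrite cards2 vb andbT; apply/subsetP => x; rewrite !inE.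
    by case/orP=> /eqP->; rewrite ?eqxx ?vA ?orbT.
  by rewrite eqxx andbT (subset_trans eA) // subsetUr.
- have toV x : x \in b |: A -> connect (adj E') v x.
    by rewrite !inE => /orP[/eqP->//|xA]; apply: sE; exact: tree_connect tr _ _ _ _.
  apply/forall_inP => x /toV xv; apply/forall_inP => y /toV; apply: connect_trans.
  by rewrite csym.
- apply/acyclicP => s /andP[cs us]; rewrite leqNgt; apply/negP => s2.
  have [bs|bs] := boolP (b \in s); last first.
    have cs' : cycle (adj E) s.
      apply: (@sub_in_cycle _ (mem s) (adj E')) cs; last by apply/allP.
      move=> x y xs ys; rewrite /adj !inE => /orP[/eqP eq2|//].
      have := set22 v b; rewrite -eq2 !inE.
      by case/orP=> /eqP bxy; move: bs; rewrite bxy ?[_ \in s]xs ?[_ \in s]ys.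
    have /acyclicP/(_ s) : acyclic E by case/and3P: tr.
    by rewrite /ucycle cs' us leqNgt s2 => /(_ isT).
  have [i t st] := rot_to bs.
  move: cs us s2; rewrite -(rot_cycle i) -(rot_uniq i) -(size_rot i) st.
  case: t {st} => [|x [|y t]] //= /andP[/adjb xv] /andP[_].
  rewrite rcons_path => /andP[_]; rewrite adj_sym => /adjb.
  move=> lv /andP[_] /andP[]; rewrite xv -lv => /negP hl _ _; apply: hl.
  exact: mem_last.
Qed.

End Trees.

Section Network.
Variable V : finType.

(* (A, E(T), r), with B the complement of A and [r b = None] for b in A *)
Definition prenetwork : Type :=
  ({set V} * {set {set V}} * {ffun V -> option {set V}})%type.

Definition pverts (N : prenetwork) := N.1.1.
Definition pedges (N : prenetwork) := N.1.2.
Definition prmap (N : prenetwork) := N.2.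

Definition is_network (N : prenetwork) : bool :=
  [&& (2 <= #|pverts N|)%N, is_tree (pverts N) (pedges N)
    & [forall b, if prmap N b is Some e
                 then (b \notin pverts N) && (e \in pedges N)
                 else b \in pverts N]].

Record network := Network { network_val : prenetwork; _ : is_network network_val }.

HB.instance Definition _ := [isSub for network_val].
HB.instance Definition _ := [Finite of network by <:].

(* N^{b -> v} *)
Definition specify (N : prenetwork) (b v : V) : prenetwork :=
  (b |: pverts N, [set v; b] |: pedges N,
   [ffun x => if x == b then None else prmap N x]).

(* [v] is an endpoint of [r b]; in particular [b] lies in B. *)
Definition endpoint (N : prenetwork) (b v : V) : bool :=
  if prmap N b is Some e then v \in e else false.

Definition specialization (M N : network) : bool :=
  [exists b, exists v, endpoint (val N) b v && (val M == specify (val N) b v)].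

Definition network_le : rel network := connect specialization.

Lemma network_out (N : prenetwork) b e :
  is_network N -> prmap N b = Some e -> b \notin pverts N /\ e \in pedges N.
Proof. by case/and3P=> _ _ /forallP/(_ b); case: (prmap N b) => // e' /andP[??] [<-]. Qed.

Lemma network_in (N : prenetwork) b :
  is_network N -> (prmap N b == None) = (b \in pverts N).
Proof.
by case/and3P=> _ _ /forallP/(_ b); case: (prmap N b) => [e /andP[/negbTE-> _]|->].
Qed.

Lemma endpointP (N : prenetwork) b v :
  is_network N -> endpoint N b v -> b \notin pverts N /\ v \in pverts N.
Proof.
move=> nN; rewrite /endpoint; case rb: (prmap N b) => [e|] // ve.
have [bN eN] := network_out nN rb; split=> //.
case/and3P: nN => _ tr _; have [/subsetP sub _] := tree_edge tr eN; exact: sub.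
Qed.

Lemma is_network_specify (N : prenetwork) b v :
  is_network N -> endpoint N b v -> is_network (specify N b v).
Proof.
move=> nN ebv; have [bN vN] := endpointP nN ebv.
case/and3P: (nN) => sz tr /forallP fN; apply/and3P; split.
- by rewrite (leq_trans sz) // subset_leq_card // subsetUr.
- exact: tree_leaf.
apply/forallP => x; rewrite /specify /prmap ffunE /pverts /pedges /= !inE.
have [//|xb] := eqVneq x b; have := fN x; rewrite /prmap /pverts /pedges.
by case: (N.2 x) => [e /andP[/negbTE xA eE]|->] //; rewrite !inE xA eE orbT.
Qed.

Lemma specialization_card M N : specialization M N ->
  #|pverts (val M)| = #|pverts (val N)|.+1.
Proof.
case/existsP=> b /existsP[v /andP[ebv /eqP ->]].
have [bN _] := endpointP (valP N) ebv.
by rewrite /specify /pverts /= cardsU1 -/(pverts _) bN.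
Qed.

Lemma network_le_card M N : network_le M N ->
  (#|pverts (val N)| <= #|pverts (val M)| ?= iff (M == N))%N.
Proof.
case/connectP=> p; elim: p M => [|M' p IH] M /=; first by move=> _ ->; rewrite eqxx; exact/leqif_refl.
case/andP=> /specialization_card MM' pp lp; have [le _] := IH _ pp lp.
have lt : (#|pverts (val N)| < #|pverts (val M)|)%N by rewrite MM' ltnS.
split; first exact: ltnW.
by rewrite ltn_eqF //; case: eqP lt => // ->; rewrite ltnn.
Qed.

Fact network_le_anti : antisymmetric network_le.
Proof.
move=> M N /andP[/network_le_card[h1 h2] /network_le_card[h3 _]].
by apply/eqP; rewrite -h2 eqn_leq h1 h3.
Qed.

Fact network_display : Order.disp_t. Proof. exact: (Order.Disp tt tt). Qed.

HB.instance Definition _ :=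
  Order.Le_isPOrder.Build network_display network
    (@connect0 _ specialization) network_le_anti (@connect_trans _ specialization).

(* The network obtained from [N] by attaching every [b] with [c b = Some v]
   to [v]. *)
Definition resolve (N : prenetwork) (c : V -> option V) : prenetwork :=
  (pverts N :|: [set b | c b != None],
   pedges N :|: [set e | [exists b, exists v, (c b == Some v) && (e == [set v; b])]],
   [ffun b => if c b is Some _ then None else prmap N b]).

Definition choice_of (N : prenetwork) (c : V -> option V) :=
  forall b v, c b = Some v -> endpoint N b v.

Lemma in_specify_edges N b v e :
  (e \in pedges (specify N b v)) = (e == [set v; b]) || (e \in pedges N).
Proof. by rewrite {1}/pedges /= !inE. Qed.

Lemma in_resolve_edges N c e :
  reflect (e \in pedges N \/ exists b v, c b = Some v /\ e = [set v; b])
          (e \in pedges (resolve N c)).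
Proof.
rewrite {1}/pedges /= !inE; apply: (iffP orP) => -[->|]; try by left.
  by case/existsP=> b /existsP[v /andP[/eqP h /eqP ->]]; right; exists b, v.
case=> b [v [h ->]]; right; apply/existsP; exists b; apply/existsP; exists v.
by rewrite h !eqxx.
Qed.

Lemma resolve_none N c : (forall b, c b = None) -> resolve N c = N.
Proof.
move=> c0; case: N => [[A E] r]; rewrite /resolve /pverts /pedges /prmap /=.
congr (_, _, _).
- by apply/setP => x; rewrite !inE c0 orbF.
- apply/setP => e; rewrite !inE; case: existsP => [[b /existsP[v]]|]; last by rewrite orbF.
  by rewrite c0.
by apply/ffunP => x; rewrite ffunE c0.
Qed.

Lemma prenetwork_eq (M N : prenetwork) :
  pverts M =i pverts N -> pedges M =i pedges N -> prmap M =1 prmap N -> M = N.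
Proof.
by case: M N => [[A E] r] [[A' E'] r'] /setP/= h1 /setP/= h2 /ffunP/= h3; congr (_, _, _).
Qed.

Lemma resolve_step N b v c : c b = Some v ->
  resolve N c = resolve (specify N b v) (fun x => if x == b then None else c x).
Proof.
move=> cb; apply: prenetwork_eq => x.
- rewrite /pverts /= !inE; have [->|] := eqVneq x b; last by [].
  by rewrite cb /= orbT.
- apply/in_resolve_edges/in_resolve_edges; rewrite in_specify_edges.
    case=> [->|[b' [w [h ->]]]]; first by left; rewrite orbT.
    have [bb|bb] := eqVneq b' b; last by right; exists b', w; rewrite (negbTE bb).
    by left; move: h; rewrite bb cb => -[->]; rewrite eqxx.
  case=> [/orP[/eqP->|->]|[b' [w []]]]; [by right; exists b, v|by left|].
  by case: eqP => // _ h ->; right; exists b', w.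
- rewrite /prmap /= !ffunE; have [->|] := eqVneq x b; last by [].
  by rewrite cb.
Qed.

Lemma resolve_ex (N : network) c : choice_of (val N) c ->
  exists2 M : network, val M = resolve (val N) c & M <= N.
Proof.
have [m] := ubnP #|[set b | c b != None]|; elim: m N c => // m IH N c cm ch.
have [/cards0_eq c0|] := posnP #|[set b | c b != None]|.
  exists N => //; rewrite resolve_none // => b; apply/eqP.
  by have := in_set0 b; rewrite -c0 inE => /negbT; rewrite negbK.
case/card_gt0P=> b; rewrite inE; case cb: (c b) => [v|] // _.
have nN' := is_network_specify (valP N) (ch _ _ cb).
pose N' := Network nN'; pose c' x := if x == b then None else c x.
have [||M vM MN'] := IH N' c'.
- rewrite -ltnS (leq_trans _ cm) // ltnS; apply: proper_card; apply/properP; split.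
    by apply/subsetP => x; rewrite !inE /c'; have [] := eqVneq x b.
  by exists b; rewrite inE ?cb // /c' eqxx.
- move=> x w; rewrite /c'; have [//|xb] := eqVneq x b; move=> /ch.
  by rewrite /endpoint {2}/prmap /= ffunE (negbTE xb).
exists M; first by rewrite vM (resolve_step _ cb).
apply: le_trans MN' _; apply: connect1; apply/existsP; exists b; apply/existsP; exists v.
by rewrite (ch _ _ cb) eqxx.
Qed.

Lemma le_resolve (M N : network) : M <= N ->
  exists2 c, choice_of (val N) c & val M = resolve (val N) c.
Proof.
case/connectP=> p; elim: p M => [|M' p IH] M /=.
  by move=> _ ->; exists (fun=> None) => //; rewrite resolve_none.
case/andP=> /existsP[b /existsP[v /andP[ebv /eqP vM]]] pp lp.
have [c ch vM'] := IH _ pp lp.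
have cb : c b = None.
  by move: ebv; rewrite /endpoint vM' /prmap ffunE; case: (c b).
exists (fun x => if x == b then Some v else c x).
  move=> x w; case: eqP => [-> [<-]|_]; last exact: ch.
  by move: ebv; rewrite /endpoint vM' {1}/prmap /= ffunE cb.
rewrite (@resolve_step _ b v) ?eqxx // vM vM'; apply: prenetwork_eq => x.
- rewrite /pverts /= !inE; have [->|xb] := eqVneq x b; first by [].
  by rewrite orFb.
- rewrite in_specify_edges; apply/orP/in_resolve_edges; rewrite in_specify_edges.
    case=> [->|/in_resolve_edges[->|[b' [w [h ->]]]]]; rewrite ?orbT; [by left..|].
    right; exists b', w; split=> //.
    by have [bb|] := eqVneq b' b; first by rewrite bb cb in h.
  case=> [/orP[->|h]|[b' [w [h ->]]]]; [by left|right..].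
    by apply/in_resolve_edges; left.
  apply/in_resolve_edges; right; exists b', w; split=> //.
  by move: h; have [] := eqVneq b' b.
- by rewrite /prmap /= !ffunE; have [] := eqVneq x b.
Qed.

Lemma resolve_le (M M' N : network) c c' :
  choice_of (val N) c -> choice_of (val N) c' ->
  val M = resolve (val N) c -> val M' = resolve (val N) c' ->
  reflect (forall b, c' b = None \/ c b = c' b) (M <= M').
Proof.
move=> ch ch' vM vM'; apply: (iffP idP).
  case/le_resolve=> d chd vMd b.
  case c'b: (c' b) => [v|]; [right|by left].
  have [bN vN] := endpointP (valP N) (ch' _ _ c'b).
  have : [set v; b] \in pedges (val M).
    rewrite vMd; apply/in_resolve_edges; left; rewrite vM'.
    by apply/in_resolve_edges; right; exists b, v.
  rewrite vM => /in_resolve_edges[|[b' [w [cb' eq2]]]].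
    case/and3P: (valP N) => _ tr _ /(tree_edge tr)[/subsetP/(_ b)].
    by rewrite set22 (negbTE bN) => /(_ isT).
  have [b'N wN] := endpointP (valP N) (ch _ _ cb').
  have bb : b' = b.
    have : b' \in [set v; b] by rewrite eq2 set22.
    by rewrite !inE => /orP[]/eqP // b'v; rewrite b'v vN in b'N.
  rewrite bb in cb' eq2; rewrite cb'; congr Some.
  have : v \in [set w; b] by rewrite -eq2 set21.
  by rewrite !inE => /orP[]/eqP // vb; rewrite vb (negbTE bN) in vN.
move=> h; pose d b := if c' b is Some _ then None else c b.
have chd : choice_of (val M') d.
  move=> b v; rewrite /d; case c'b: (c' b) => // /ch.
  by rewrite /endpoint vM' {2}/prmap /= ffunE c'b.
have [M2 vM2 leM2] := resolve_ex chd.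
suff -> : M = M2 by [].
apply: val_inj; rewrite vM vM2 vM'; apply: prenetwork_eq => x.
- rewrite /pverts /= !inE /d -orbA; congr orb.
  by case: (h x) => ->; [rewrite /=|case: (c' x)].
- apply/in_resolve_edges/in_resolve_edges.
    case=> [xE|[b [v [cb ->]]]]; first by left; apply/in_resolve_edges; left.
    case c'b: (c' b) => [w|]; last by right; exists b, v; rewrite /d c'b.
    left; apply/in_resolve_edges; right; exists b, v; split=> //.
    by case: (h b) => [|<-//]; rewrite c'b.
  case=> [/in_resolve_edges[xE|[b [v [c'b ->]]]]|[b [v []]]].
  + by left.
  + by right; exists b, v; split=> //; case: (h b); rewrite c'b.
  rewrite /d; case: (c' b) => // cb ->; by right; exists b, v.
- rewrite /prmap /= !ffunE /d; case: (h x) => ->; first by case: (c x).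
  by case: (c' x).
Qed.

Definition network_dim (N : network) : nat := #|~: pverts (val N)|.

Definition end_of (x : V) (e : {set V}) (s : bool) : V := nth x (enum e) s.

Lemma end_ofP x (e : {set V}) : #|e| = 2 ->
  [/\ forall s, end_of x e s \in e,
      forall v, v \in e -> exists s, v = end_of x e s
    & injective (end_of x e)].
Proof.
rewrite cardE => se; have ue := enum_uniq e; split.
- by move=> s; rewrite -mem_enum mem_nth // se; case: s.
- move=> v; rewrite -mem_enum => ve; exists (index v (enum e) == 1%N).
  have := ve; rewrite -index_mem se /end_of; case E: (index v (enum e)) => [|[|]] // _ /=;
  by rewrite -{1}(nth_index x ve) E.
- move=> s t; rewrite /end_of => /eqP; rewrite nth_uniq ?se //; try by [case: s|case: t].
  by case: s t => [] [].
Qed.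

Fact network_chart (N : network) :
  exists2 phi : cube (network_dim N) -> network,
    {mono phi : c c' / c <= c'} & forall M, (M <= N) = (M \in codom phi).
Proof.
pose B := ~: pverts (val N).
pose ch (c : cube #|B|) b : option V :=
  match prmap (val N) b with
  | Some e => omap (end_of b e) (pull c b)
  | None => None
  end.
have eP b e : prmap (val N) b = Some e -> #|e| = 2.
  case/(network_out (valP N)) => _ eE.
  by case/and3P: (valP N) => _ tr _; case: (tree_edge tr eE).
have chP c : choice_of (val N) (ch c).
  move=> b v; rewrite /ch /endpoint; case rb: (prmap (val N) b) => [e|] //.
  by case: (pull c b) => //= s [<-]; have [-> _ _] := end_ofP b (eP _ _ rb).
pose good (c : cube #|B|) (M : network) := val M == resolve (val N) (ch c).
have gex c : exists M, good c M.
  by have [M vM _] := resolve_ex (chP c); exists M; apply/eqP.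
pose phi c := xchoose (gex c).
have phiE c : val (phi c) = resolve (val N) (ch c) by apply/eqP/(xchooseP (gex c)).
have rB b : b \in B -> exists2 e, prmap (val N) b = Some e & #|e| = 2.
  rewrite inE -(network_in _ (valP N)); case rb: (prmap (val N) b) => [e|] // _.
  by exists e => //; exact: eP rb.
exists phi.
  move=> c c'; apply/(resolve_le (chP c) (chP c') (phiE c) (phiE c'))/cubeP => h.
    move=> j; have := h (enum_val j).
    have [e re e2] := rB _ (enum_valP j); rewrite /ch re !pull_val.
    have [_ _ inj] := end_ofP (enum_val j) e2.
    case: (c j) => [s|]; case: (c' j) => [t|] /=; try by [left | case].
    by case=> // -[/inj->]; right.
  move=> b; rewrite /ch; case rb: (prmap (val N) b) => [e|]; last by left.
  have bB : b \in B by rewrite inE; have [] := network_out (valP N) rb.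
  have [j ->] := enum_val_ex bB.
  by rewrite !pull_val; case: (h j) => ->; [left | right].
move=> M; apply/idP/codomP => [/le_resolve[c hc vM]|[c ->]]; last first.
  have [M' vM' leM'] := resolve_ex (chP c).
  by suff -> : phi c = M' by []; apply: val_inj; rewrite phiE vM'.
pose c2 (b : V) : option bool :=
  if c b is Some v then
    if prmap (val N) b is Some e then Some (v == end_of b e true) else None
  else None.
pose c' : cube #|B| := [ffun j => c2 (enum_val j)].
suff cE : ch c' =1 c.
  exists c'; apply: val_inj; rewrite phiE vM; apply: prenetwork_eq => x.
  - by rewrite /pverts /= !inE cE.
  - by apply/in_resolve_edges/in_resolve_edges => -[|[b [v [hb ->]]]];
      [left | right; exists b, v; rewrite cE |
       left | right; exists b, v; rewrite -cE].
  - by rewrite /prmap /= !ffunE cE.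
move=> b; rewrite /ch; case rb: (prmap (val N) b) => [e|]; last first.
  by case cb: (c b) => [v|] //; have := hc _ _ cb; rewrite /endpoint rb.
have bB : b \in B by rewrite inE; have [] := network_out (valP N) rb.
have -> : pull c' b = c2 b by have [j ->] := enum_val_ex bB; rewrite pull_val ffunE.
rewrite /c2 rb; case cb: (c b) => [v|] //=; congr Some.
have := hc _ _ cb; rewrite /endpoint rb.
have [_ sur inj] := end_ofP b (eP _ _ rb) => /sur[s ->].
by rewrite (inj_eq inj); case: s.
Qed.

HB.instance Definition _ :=
  isCubical.Build network_display network network_chart.

End Network.

Definition realignment_complex (n : nat) : cubicalType network_display :=
  network 'I_n.

(* Main.v *)
Require Import Defs.
From mathcomp Require Import all_boot all_order zify.

(** A vertex of the complex is a tree on the whole vertex set, and an edge of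
    the complex is a slide: a leaf [b] attached to [u] moves to a neighbour
    [v] of [u].  Everything follows from an analysis of 4-cycles of slides.

    Going round a 4-cycle, the four removed tree edges (the stubs [u b]) and
    the four added ones ([v b]) cancel, so they agree up to a permutation, and
    no slide adds the edge that it removes: the permutation is one of the nine
    derangements of four slides.  In two of them some slide undoes the
    preceding one, so that two opposite corners coincide.  In one rotation
    every stub is removed by the slide that follows the one adding it; then a
    single leaf walks round a 4-cycle of the tree.  In the opposite rotation
    every removed stub is restored at once, in the only way that does not
    undo the slide: [u] becomes a leaf and hops onto [b]; three such hops leave
    [b] attached to [v] instead of [u].  Four more derangements are rotations
    of one configuration ([slide_square_mixed]).  The one left pairs opposite
    slides, which are then the same slide in opposite directions
    ([slide_square]).

    Given an injective map of the 1-skeleton of the [k]-cube, the slides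
    [b_i : u_i -> v_i] met at one corner are therefore met, in direction [i],
    at all corners, and the leaves [b_i] are distinct from each other and from
    all [u_j], [v_j].  Detaching the leaves [b_i] from the tree at that corner
    and recording [r(b_i) = u_i v_i] gives a network of dimension [k], whose
    cube of faces extends the map ([filling_extension]).

    For uniqueness, and for the agreement of this extension with the given map
    on edges, it suffices to compare corners, since a cell is determined by its
    vertices ([vertices_inj]): its tree edges are those common to all its
    vertices, and its map [r] is read off the stubs that some vertex has. *)

Set Implicit Arguments.
Unset Strict Implicit.
Unset Printing Implicit Defensive.
Import Order.TTheory.

(** * Slides of a leaf along an edge *)

Section Slides.
Variable V : finType.
Implicit Types (b c u v w x : V) (e : {set V}) (E : {set {set V}}).

Lemma eq_set2P a b c d :
  [set a; b] = [set c; d] :> {set V} -> (a = c /\ b = d) \/ (a = d /\ b = c).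
Proof.
move=> h.
have := set21 a b; rewrite h !inE; have := set22 a b; rewrite h !inE.
have := set21 c d; rewrite -h !inE; have := set22 c d; rewrite -h !inE.
by do 4 (case/orP=> /eqP ?); intuition congruence.
Qed.

(** [E0] is the tree without the leaf [b], so that [slide b u v] relates the two
    vertices of the edge cell with tree [E0] and [r(b) = {u, v}]. *)
Definition slide b u v E E' := exists E0,
  [/\ E = [set u; b] |: E0, E' = [set v; b] |: E0, [set u; v] \in E0, u != v
    & forall e, e \in E0 -> b \notin e].

Lemma slide_sym b u v E E' : slide b u v E E' -> slide b v u E' E.
Proof. by case=> E0 [-> -> uv nuv bE]; exists E0; rewrite (setUC [set v] [set u]) eq_sym. Qed.

Lemma slide_neq b u v E E' : slide b u v E E' -> [/\ u <> v, b <> u & b <> v].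
Proof.
case=> E0 [_ _ uvE /eqP nuv /(_ _ uvE)]; rewrite !inE negb_or.
by case/andP=> /eqP ? /eqP ?; split.
Qed.

Lemma slide_axis b u v E E' : slide b u v E E' -> adj E u v.
Proof. by case=> E0 [-> _ uv _ _]; rewrite /adj !inE uv orbT. Qed.

Lemma slide_stub b u v E E' : slide b u v E E' -> adj E u b.
Proof. by case=> E0 [-> _ _ _ _]; rewrite /adj !inE eqxx. Qed.

Lemma slide_leaf b u v E E' x : slide b u v E E' -> adj E x b -> x = u.
Proof.
case=> E0 [-> _ _ _ bE]; rewrite /adj !inE => /orP[/eqP/eq_set2P|/bE].
  by case=> -[-> ?].
by rewrite set22.
Qed.

Lemma slide_keep b u v E E' e :
  slide b u v E E' -> b \notin e -> (e \in E') = (e \in E).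
Proof.
case=> E0 [-> -> _ _ _] be; rewrite !inE.
by congr orb; apply/eqP/eqP => h; move: be; rewrite h set22.
Qed.

(** The form in which the changes along a closed walk are added up. *)
Lemma slide_count b u v E E' e : slide b u v E E' ->
  (e \in E') + (e == [set u; b]) = (e \in E) + (e == [set v; b]).
Proof.
move=> s; case: (slide_neq s) => nuv nbu nbv; case: s => E0 [-> -> _ _ bE].
rewrite !inE; have nE w : [set w; b] \notin E0 by apply/negP => /bE; rewrite set22.
have [->|n1] := eqVneq e [set u; b].
  have [|_] := eqVneq; first by case/eq_set2P => -[].
  by rewrite (negbTE (nE u)).
by have [->|n2] := eqVneq e [set v; b]; rewrite ?(negbTE (nE _)) //= addn0.
Qed.

Lemma slide_fun b u v E E' E'' : slide b u v E E' -> slide b u v E E'' -> E' = E''.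
Proof.
move=> s1 s2; apply/setP => e.
by have := slide_count e s1; rewrite -(slide_count e s2) => /addIn; do 2 case: in_mem.
Qed.

(** The base [u] has two neighbours, [b] and [v], while [c] has only one. *)
Lemma slide_base_leaf b u v E E' c w x E'' :
  slide b u v E E' -> slide c w x E E'' -> c <> u.
Proof.
move=> s1 s2 cu; have [_ _ nbv] := slide_neq s1; apply: nbv; subst c.
rewrite (slide_leaf (x := v) s2); last by rewrite adj_sym (slide_axis s1).
by rewrite (slide_leaf (x := b) s2) // adj_sym (slide_stub s1).
Qed.

(** A stub is an unordered pair of vertices, but the tree tells its leaf from
    its base. *)
Lemma stub_inj b u v E E' c w x E'' :
  slide b u v E E' -> slide c w x E E'' -> [set u; b] = [set w; c] ->
  b = c /\ u = w.
Proof.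
move=> s1 s2 /eq_set2P[[-> ->]//|[uc _]].
by case: (slide_base_leaf s1 s2).
Qed.

Lemma slide_no_return b u v c w x E1 E2 E3 :
  slide b u v E1 E2 -> slide c w x E2 E3 -> E1 <> E3 ->
  [set u; b] = [set x; c] -> [set w; c] = [set v; b] -> False.
Proof.
move=> s1 s2 nE h1 h2; have [cb wv] := stub_inj s2 (slide_sym s1) h2; subst c w.
have xu : x = u by case: (eq_set2P h1) => [[]|[? <-]].
by subst x; apply: nE; apply: slide_fun (slide_sym s1) s2.
Qed.

(** The edge [u b] can come back with [b] as its leaf only if the second slide
    undoes the first; otherwise it comes back with [u] as its leaf. *)
Lemma slide_turn b u v c w x E1 E2 E3 :
  slide b u v E1 E2 -> slide c w x E2 E3 -> E1 <> E3 ->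
  [set u; b] = [set x; c] -> [/\ c = u, w = v & x = b].
Proof.
move=> s1 s2 nE h; case: (eq_set2P h) => -[ux bc]; subst.
  case: (slide_no_return s1 s2 nE) => //; congr [set _; _].
  exact/(slide_leaf (slide_sym s1))/(slide_stub s2).
split=> //; apply/esym/(slide_leaf s2).
exact: slide_axis (slide_sym s1).
Qed.

(** The last two slides share a stub at [E4], hence move one leaf, and this
    leaf must be [v1], on its way from [b1] to [u1].  But in [E3] the vertex [u1]
    is itself a leaf attached to [b1], so the place halfway between them would
    be [b1], where the leaf already was. *)
Lemma slide_square_mixed b1 u1 v1 b2 u2 v2 b3 u3 v3 b4 u4 v4 E1 E2 E3 E4 :
  slide b1 u1 v1 E1 E2 -> slide b2 u2 v2 E2 E3 ->
  slide b3 u3 v3 E3 E4 -> slide b4 u4 v4 E4 E1 -> E1 <> E3 ->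
  [set u1; b1] = [set v2; b2] -> [set u2; b2] = [set v4; b4] ->
  [set u4; b4] = [set v3; b3] -> [set u3; b3] = [set v1; b1] -> False.
Proof.
move=> s1 s2 s3 s4 nE h12 h24 h43 h31.
have [? ? ?] := slide_turn s1 s2 nE h12; subst b2 u2 v2.
have [? ?] := stub_inj s4 (slide_sym s3) h43; subst b4 u4.
have [nuv nbu nbv] := slide_neq s1; have [nuv3 _ _] := slide_neq s3.
have [_ nb3v3 nb3v4] := slide_neq s4.
have [? ?] : b3 = v1 /\ v4 = u1.
  by case: (eq_set2P h24) (eq_set2P h31) => -[? ?] [] [? ?]; subst.
subst b3 v4; have ? : u3 = b1 by case: (eq_set2P h31) => -[? ?]; subst.
subst u3; apply: nuv3; symmetry.
apply: (slide_leaf (slide_sym s2)).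
have := slide_axis s4; rewrite /adj (slide_keep s3) // !inE negb_or.
by apply/andP; split; apply/eqP => // ?; case: nuv.
Qed.

Lemma perm_eq4_derangement (T : eqType) (s1 s2 s3 s4 t1 t2 t3 t4 : T) :
  perm_eq [:: s1; s2; s3; s4] [:: t1; t2; t3; t4] ->
  s1 <> t1 -> s2 <> t2 -> s3 <> t3 -> s4 <> t4 ->
  (s1 = t2 /\ s2 = t1 /\ s3 = t4 /\ s4 = t3) \/
  (s1 = t2 /\ s2 = t3 /\ s3 = t4 /\ s4 = t1) \/
  (s1 = t2 /\ s2 = t4 /\ s3 = t1 /\ s4 = t3) \/
  (s1 = t3 /\ s2 = t4 /\ s3 = t1 /\ s4 = t2) \/
  (s1 = t3 /\ s2 = t1 /\ s3 = t4 /\ s4 = t2) \/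
  (s1 = t3 /\ s2 = t4 /\ s3 = t2 /\ s4 = t1) \/
  (s1 = t4 /\ s2 = t3 /\ s3 = t2 /\ s4 = t1) \/
  (s1 = t4 /\ s2 = t1 /\ s3 = t2 /\ s4 = t3) \/
  (s1 = t4 /\ s2 = t3 /\ s3 = t1 /\ s4 = t2).
Proof.
have step a (s t : seq T) : perm_eq (a :: s) t -> exists i,
    [/\ i < size t, a = nth a t i & perm_eq s (take i t ++ drop i.+1 t)].
  move=> h; have at_ : a \in t by rewrite -(perm_mem h) mem_head.
  exists (index a t); split; rewrite ?index_mem ?nth_index // -remE.
  by rewrite -(perm_cons a) (permPl h) perm_to_rem.
move=> h0 n1 n2 n3 n4; case/step: h0 => -[|[|[|[|i]]]] [] //= lt1 e1 h1.
all: case/step: h1 => -[|[|[|j]]] [] //= lt2 e2 h2.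
all: case/step: h2 => -[|[|k]] [] //= lt3 e3 h3.
all: case/step: h3 => -[|l] [] //= lt4 e4 _.
all: by clear step; tauto.
Qed.

Lemma acyclic_no_cycle4 E u1 u2 u3 u4 : acyclic E ->
  adj E u1 u2 -> adj E u2 u3 -> adj E u3 u4 -> adj E u4 u1 ->
  uniq [:: u1; u2; u3; u4] -> False.
Proof.
move=> /acyclicP/(_ [:: u1; u2; u3; u4]) ac a12 a23 a34 a41 un.
by have := ac; rewrite /ucycle un /= a12 a23 a34 a41 => /(_ isT).
Qed.

(** Consecutive slides share a stub, so a single leaf moves through the bases
    [u1], [u2], [u3], [u4], which form a 4-cycle of the tree without that leaf. *)
Lemma slide_square_one_leaf b1 u1 v1 b2 u2 v2 b3 u3 v3 b4 u4 v4 E1 E2 E3 E4 :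
  acyclic E1 ->
  slide b1 u1 v1 E1 E2 -> slide b2 u2 v2 E2 E3 ->
  slide b3 u3 v3 E3 E4 -> slide b4 u4 v4 E4 E1 -> E1 <> E3 -> E2 <> E4 ->
  [set u2; b2] = [set v1; b1] -> [set u3; b3] = [set v2; b2] ->
  [set u4; b4] = [set v3; b3] -> [set u1; b1] = [set v4; b4] -> False.
Proof.
move=> ac s1 s2 s3 s4 n13 n24 h21 h32 h43 h14.
have [? ?] := stub_inj s2 (slide_sym s1) h21; subst b2 u2.
have [? ?] := stub_inj s3 (slide_sym s2) h32; subst b3 u3.
have [? ?] := stub_inj s4 (slide_sym s3) h43; subst b4 u4.
have [_ ?] := stub_inj s1 (slide_sym s4) h14; subst v4.
have [n1 nu nv1] := slide_neq s1; have [n2 _ nv2] := slide_neq s2.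
have [n3 _ nv3] := slide_neq s3; have [n4 _ _] := slide_neq s4.
have k y z : b1 <> y -> b1 <> z -> b1 \notin [set y; z].
  by rewrite !inE negb_or => ? ?; apply/andP; split; apply/eqP.
apply: (acyclic_no_cycle4 ac (slide_axis s1) (u3 := v2) (u4 := v3)).
- by rewrite /adj -(slide_keep s1) ?k //; exact: slide_axis s2.
- rewrite /adj -(slide_keep s1) ?k // -(slide_keep s2) ?k //.
  exact: slide_axis s3.
- by rewrite /adj (slide_keep s4) ?k //; exact: slide_axis s4.
have n1v2 : u1 <> v2.
  by move=> h; subst; apply: n13; exact: slide_fun (slide_sym s1) s2.
have n2v3 : v1 <> v3.
  by move=> h; subst; apply: n24; exact: slide_fun (slide_sym s2) s3.
rewrite /= !inE !negb_or; do ![apply/andP; split] => //; apply/eqP => //; congruence.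
Qed.

Lemma slide_square b1 u1 v1 b2 u2 v2 b3 u3 v3 b4 u4 v4 E1 E2 E3 E4 :
  acyclic E1 ->
  slide b1 u1 v1 E1 E2 -> slide b2 u2 v2 E2 E3 ->
  slide b3 u3 v3 E3 E4 -> slide b4 u4 v4 E4 E1 -> E1 <> E3 -> E2 <> E4 ->
  [/\ b3 = b1, u3 = v1 & v3 = u1] /\ [/\ b4 = b2, u4 = v2 & v4 = u2].
Proof.
move=> ac s1 s2 s3 s4 n13 n24; have n31 := nesym n13; have n42 := nesym n24.
have nst b u v E E' : slide b u v E E' -> [set u; b] <> [set v; b].
  by case/slide_neq=> nuv nbu _ /eq_set2P [[]|[]] //; congruence.
have perm : perm_eq [:: [set u1; b1]; [set u2; b2]; [set u3; b3]; [set u4; b4]]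
    [:: [set v1; b1]; [set v2; b2]; [set v3; b3]; [set v4; b4]].
  apply/allP => a _ /=; apply/eqP.
  have := slide_count a s1; have := slide_count a s2.
  have := slide_count a s3; have := slide_count a s4.
  rewrite !(eq_sym a); lia.
(* The case where the second slide undoes the first. *)
have [] // := perm_eq4_derangement perm (nst _ _ _ _ _ s1) (nst _ _ _ _ _ s2)
  (nst _ _ _ _ _ s3) (nst _ _ _ _ _ s4).
  by case=> h12 [h21 _]; exfalso; apply: (slide_no_return s1 s2 n13).
case; [|case; [|case; [|case; [|case; [|case; [|case]]]]]] => -[h1 [h2 [h3 h4]]].
(* One turn sends [(b, u, v)] to [(u, v, b)], so after three the leaf is [b]
   again and it is slid back into [E1], but with base [v]. *)
- have [? ? ?] := slide_turn s1 s2 n13 h1; subst b2 u2 v2.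
  have [? ? ?] := slide_turn s2 s3 n24 h2; subst b3 u3 v3.
  have [? ? ?] := slide_turn s3 s4 n31 h3; subst b4 u4 v4.
  have [nuv _ _] := slide_neq s1.
  by case: nuv; apply/esym/(slide_leaf s1)/(slide_stub (slide_sym s4)).
- by exfalso; apply: (slide_square_mixed s1 s2 s3 s4).
- have [? ? ?] := slide_neq s1; have [? ? ?] := slide_neq s2.
  split; [move: (eq_set2P h1) (eq_set2P h3)|move: (eq_set2P h2) (eq_set2P h4)];
    by case=> -[? ?] [] [? ?]; split; congruence.
- by exfalso; apply: (slide_square_mixed s3 s4 s1 s2).
- by exfalso; apply: (slide_square_mixed s4 s1 s2 s3).
- by exfalso; apply: (slide_no_return s4 s1 n42).
- by exfalso; apply: (slide_square_one_leaf ac s1 s2 s3 s4).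
- by exfalso; apply: (slide_square_mixed s2 s3 s4 s1).
Qed.

(** The form used to carry slides across a cube: the slides out of [E1] are
    known, the two opposite ones are only known to exist. *)
Lemma slide_square_commute b u v c w x E1 E2 E3 E4 :
  acyclic E1 ->
  slide b u v E1 E2 -> slide c w x E1 E4 ->
  (exists b' u' v', slide b' u' v' E2 E3) ->
  (exists c' w' x', slide c' w' x' E4 E3) ->
  E1 <> E3 -> E2 <> E4 ->
  [/\ slide b u v E4 E3, b <> c & c \notin [set u; v]].
Proof.
move=> ac s1 s4 [c' [w' [x' s2]]] [b' [u' [v' s3]]] n13 n24.
have [[? ? ?] [? ? ?]] :=
  slide_square ac s1 s2 (slide_sym s3) (slide_sym s4) n13 n24.
subst b' v' u' c' w' x'.
have ncu := slide_base_leaf s1 s4; have ncv := slide_base_leaf (slide_sym s1) s2.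
split=> //; last by rewrite !inE; apply/norP; split; apply/eqP.
(* A leaf common to both slides hangs from [w] both in [E1] and in [E2]. *)
move=> ?; subst c; have [nuv _ _] := slide_neq s1; apply: nuv.
by rewrite -(slide_leaf s1 (slide_stub s4)) -(slide_leaf (slide_sym s1) (slide_stub s2)).
Qed.
End Slides.

(** * Trees and cells of the complex *)

Section Prune.
Variable V : finType.

(** Moving every vertex of [L] to its only neighbour retracts the tree onto the
    rest, so connectedness is preserved. *)
Lemma tree_prune (A L : {set V}) (E : {set {set V}}) (base : V -> V) :
  is_tree A E -> {in L, forall b, base b \notin L} ->
  {in L, forall b x, adj E x b -> x = base b} ->
  is_tree (A :\: L) [set e in E | [disjoint e & L]].
Proof.
move=> tr baseL leafL; set E0 := [set e in E | _].
pose rho x := if x \in L then base x else x.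
have step x y : adj E x y -> connect (adj E0) (rho x) (rho y).
  rewrite /rho => xy; case: ifPn => xL.
    have -> := leafL x xL y; last by rewrite adj_sym.
    by rewrite (negbTE (baseL x xL)).
  case: ifPn => yL; first by rewrite (leafL y yL x xy).
  apply: connect1; rewrite /adj inE [_ \in E]xy /=; apply/pred0P => z /=.
  by rewrite !inE; apply/negP => /andP[/orP[]/eqP->]; apply/negP.
have conn x y : connect (adj E) x y -> connect (adj E0) (rho x) (rho y).
  case/connectP=> p; elim: p x => [|z p IH] x /=; first by move=> _ ->.
  case/andP=> xz pz lz; exact: connect_trans (step _ _ xz) (IH _ pz lz).
apply/and3P; split.
- apply/forall_inP => e; rewrite inE => /andP[/(tree_edge tr)[eA ->] eL].
  by rewrite subsetD eA eL.
- apply/forall_inP => x /setDP[xA xL]; apply/forall_inP => y /setDP[yA yL].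
  have := conn _ _ (tree_connect tr xA yA).
  by rewrite /rho (negbTE xL) (negbTE yL).
apply/acyclicP => s /andP[cs us].
have /acyclicP : acyclic E by case/and3P: tr.
apply; rewrite /ucycle us andbT.
by apply: sub_cycle cs => x y; rewrite /adj inE => /andP[].
Qed.
End Prune.

Section Vertices.
Local Open Scope order_scope.
Variable V : finType.
Implicit Types M N P Q : network V.

Lemma vertex_inj P Q :
  pverts (val P) = setT -> pverts (val Q) = setT ->
  pedges (val P) = pedges (val Q) -> P = Q.
Proof.
move=> vP vQ eE; apply/val_inj/prenetwork_eq => x; rewrite ?vP ?vQ ?eE //.
have /eqP-> : prmap (val P) x == None by rewrite (network_in _ (valP P)) vP inE.
by apply/esym/eqP; rewrite (network_in _ (valP Q)) vQ inE.
Qed.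

Lemma dim0P P : reflect (pverts (val P) = setT) (network_dim P == 0).
Proof.
rewrite /network_dim cards_eq0 -setCT (inj_eq (can_inj (@setCK _))); exact: eqP.
Qed.

Lemma set2_of_card (e : {set V}) u v :
  #|e| = 2 -> u \in e -> v \in e -> u != v -> e = [set u; v].
Proof.
move=> e2 ue ve nuv; apply/esym/eqP; rewrite eqEcard cards2 nuv e2 leqnn andbT.
by apply/subsetP => x; rewrite !inE => /orP[]/eqP->.
Qed.

Lemma network_edge N e : e \in pedges (val N) -> e \subset pverts (val N) /\ #|e| = 2.
Proof. by case/and3P: (valP N) => _ tr _; exact: tree_edge tr. Qed.

Lemma stub_notin_edges N b v : b \notin pverts (val N) -> [set v; b] \notin pedges (val N).
Proof.
move=> bN; apply/negP => /network_edge[/subsetP/(_ b)]; rewrite set22 => /(_ isT).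
by rewrite (negbTE bN).
Qed.

Lemma edge_cell_slide M P Q :
  network_dim M = 1 -> network_dim P = 0 -> network_dim Q = 0 ->
  P <= M -> Q <= M -> P <> Q ->
  exists b u v, slide b u v (pedges (val P)) (pedges (val Q)).
Proof.
move=> dM /eqP/dim0P vP /eqP/dim0P vQ /le_resolve[c chc eP] /le_resolve[d chd eQ] nPQ.
have /cards1P[b bM] : #|~: pverts (val M)| == 1 by rewrite -dM.
have bN : b \notin pverts (val M) by rewrite -in_setC bM set11.
have loc (R : network V) h : choice_of (val M) h -> val R = resolve (val M) h ->
    pverts (val R) = setT ->
    exists2 u, endpoint (val M) b u & pedges (val R) = [set u; b] |: pedges (val M).
  move=> chh eR vR; have : h b != None.
    have : b \in pverts (val R) by rewrite vR inE.
    by rewrite eR /resolve {1}/pverts /= !inE (negbTE bN).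
  case hb: (h b) => [u|] // _; exists u; first exact: chh.
  apply/setP => e; rewrite eR [in RHS]inE in_set1; apply/in_resolve_edges/orP.
    case=> [->|[b' [w [hb' ->]]]]; [by right|left].
    have [b'N _] := endpointP (valP M) (chh _ _ hb').
    move: b'N; rewrite -in_setC bM inE => /eqP b'b.
    by move: hb'; rewrite b'b hb => -[->].
  by case=> [/eqP->|]; [right; exists b, u|left].
have [u eu pP] := loc P c chc eP vP; have [v ev pQ] := loc Q d chd eQ vQ.
exists b, u, v, (pedges (val M)); split=> //.
- have nuv : u != v.
    by apply/eqP => uv; apply: nPQ; apply: vertex_inj; rewrite // pP pQ uv.
  move: eu ev; rewrite /endpoint; case rb: (prmap _ b) => [e|] // ue ve.
  have [_ eE] := network_out (valP M) rb; have [_ e2] := network_edge eE.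
  by rewrite -(set2_of_card e2 ue ve nuv).
- by apply/eqP => uv; apply: nPQ; apply: vertex_inj; rewrite // pP pQ uv.
move=> e /network_edge[/subsetP eM _]; apply: contra bN; exact: eM.
Qed.

(** These choices, one end of [r b] for every [b], give the vertices of [N]. *)
Definition total_choice (N : network V) (s : V -> bool) b : option V :=
  omap (fun e => end_of b e (s b)) (prmap (val N) b).

Lemma total_choice_of N s : choice_of (val N) (total_choice N s).
Proof.
move=> b v; rewrite /total_choice /endpoint; case rb: (prmap _ b) => [e|] //= [<-].
have [_ eE] := network_out (valP N) rb; have [_ e2] := network_edge eE.
by have [->] := end_ofP b e2.
Qed.

Lemma total_choiceP N s : exists P,
  [/\ P <= N, network_dim P = 0 & val P = resolve (val N) (total_choice N s)].
Proof.
have [P vP leP] := resolve_ex (@total_choice_of N s); exists P; split=> //.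
apply/eqP/dim0P; apply/setP => b; rewrite vP /resolve /pverts /= !inE -/(pverts _).
rewrite -(network_in _ (valP N)) /total_choice.
by case: (prmap _ b).
Qed.

Lemma edges_resolve_stub N c b v : choice_of (val N) c ->
  b \notin pverts (val N) -> v \in pverts (val N) ->
  ([set v; b] \in pedges (resolve (val N) c)) = (c b == Some v).
Proof.
move=> ch bN vN; apply/in_resolve_edges/eqP => [|cb]; last by right; exists b, v.
case=> [|[b' [w [cb']]]]; first by rewrite (negbTE (stub_notin_edges _ bN)).
have [b'N _] := endpointP (valP N) (ch _ _ cb').
case/eq_set2P=> -[? ?]; subst; first by [].
by rewrite vN in b'N.
Qed.

Lemma endpoint_vertices N b v : b \notin pverts (val N) -> v \in pverts (val N) ->
  endpoint (val N) b v <->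
  exists P, [/\ P <= N, network_dim P = 0 & [set v; b] \in pedges (val P)].
Proof.
move=> bN vN; split=> [|[P [/le_resolve[c chc eP] _]]]; last first.
  by rewrite eP (edges_resolve_stub chc) // => /eqP/chc.
rewrite /endpoint; case rb: (prmap _ b) => [e|] // ve.
have [_ eE] := network_out (valP N) rb; have [_ e2] := network_edge eE.
have [_ /(_ v ve)[s vs] _] := end_ofP b e2.
have [P [leP dP eP]] := total_choiceP N (fun=> s); exists P; split=> //.
by rewrite eP (edges_resolve_stub (@total_choice_of N _)) // /total_choice rb /= vs.
Qed.

(** A stub [v b] with [b] outside the tree of [N] is missing from the vertex that
    attaches [b] to the other end of [r b]. *)
Lemma edges_vertices N e : (e \in pedges (val N)) <->
  forall P, P <= N -> network_dim P = 0 -> e \in pedges (val P).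
Proof.
split=> [eN P /le_resolve[c _ ->] _|eP]; first by apply/in_resolve_edges; left.
have [P [leP dP vP]] := total_choiceP N (fun=> true).
have := eP P leP dP; rewrite vP => /in_resolve_edges[//|[b [v [cb eE]]]]; subst e.
have [bN vN] := endpointP (valP N) (total_choice_of cb).
have [Q [leQ dQ vQ]] := total_choiceP N (fun=> false).
have := eP Q leQ dQ; rewrite vQ (edges_resolve_stub (@total_choice_of N _)) //.
move/eqP; move: cb; rewrite /total_choice; case rb: (prmap _ b) => [r|] //= [<-] [].
have [_ rE] := network_out (valP N) rb; have [_ r2] := network_edge rE.
by have [_ _ inj] := end_ofP b r2; move/inj.
Qed.

Lemma verts_edges N x : (x \in pverts (val N)) = (x \in cover (pedges (val N))).
Proof.
apply/idP/bigcupP => [xN|[e /network_edge[/subsetP eN _] /eN //]].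
case/and3P: (valP N) => A2 tr _.
have /card_gt0P[y] : (0 < #|pverts (val N) :\ x|)%N.
  by move: A2; rewrite (cardsD1 x) xN.
case/setD1P=> yx yN; case/connectP: (tree_connect tr xN yN) => -[|z p] /=.
  by move=> _ yx'; rewrite yx' eqxx in yx.
by case/andP=> xz _ _; exists [set x; z]; rewrite // set21.
Qed.

(** The trees of the vertices determine the edges of [N], these its tree and
    its vertex set, and then the stubs at the vertices determine [r]. *)
Lemma vertices_inj M N :
  (forall P, network_dim P = 0 -> (P <= M) = (P <= N)) -> M = N.
Proof.
move=> h.
have eE : pedges (val M) = pedges (val N).
  apply/setP => e; apply/idP/idP => /edges_vertices eP; apply/edges_vertices => P leP dP;
    by apply: eP; rewrite // ?h // -h.
have eV : pverts (val M) =i pverts (val N) by move=> x; rewrite !verts_edges eE.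
have ep b v : endpoint (val M) b v = endpoint (val N) b v.
  have [bN|bN] := boolP (b \in pverts (val N)); last first.
    have [vN|vN] := boolP (v \in pverts (val N)); last first.
      apply/idP/idP => /endpointP => /(_ (valP _))[_]; by rewrite ?eV (negbTE vN).
    apply/idP/idP => /endpoint_vertices; rewrite ?eV => /(_ bN vN)[P [leP dP eP]];
      by apply/endpoint_vertices; rewrite ?eV //; exists P; split=> //; rewrite ?h // -h.
  by apply/idP/idP => /endpointP => /(_ (valP _))[+ _]; rewrite ?eV bN.
apply/val_inj/prenetwork_eq => //; first by rewrite eE.
move=> b; move: (ep b) (network_in b (valP M)) (network_in b (valP N)).
rewrite /endpoint eV => ept <-; move: ept.
case: (prmap _ b) => [e|]; case: (prmap _ b) => [e'|] //= ee _.
by congr Some; apply/setP.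
Qed.
End Vertices.

(** * Cellular maps and the cells of a cube *)

Section Cellular.
Local Open Scope order_scope.
Variables (d d' : Order.disp_t) (K : cubicalType d) (L : cubicalType d').
Implicit Types f g : K -> L.

Lemma cellular_homo f : cellular f -> {homo f : x y / x <= y}.
Proof. by move=> cf x y xy; have [mf _] := cf y; rewrite mf ?inE. Qed.

(** The number of faces of a cell, [3 ^ cdim], is preserved. *)
Lemma cellular_cdim f x : cellular f -> cdim (f x) = cdim x.
Proof.
move=> cf; apply/eqP; rewrite -(@eqn_exp2l 3) // -!card_ideal; apply/eqP.
have [mf sf] := cf x; have injf : {in [pred y | y <= x] &, injective f}.
  by move=> y z yx zx fyz; apply/le_anti; rewrite -!mf // fyz lexx.
rewrite -(card_in_image injf); apply: eq_card => w; rewrite inE.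
apply/idP/imageP => [/sf[y yx <-]|[y yx ->]]; first by exists y.
exact: cellular_homo.
Qed.

Lemma cellular_skeleton m f : cellular f -> cellular (fun x : skeleton m K => f (val x)).
Proof.
move=> cf x; have [mf sf] := cf (val x); split.
  by move=> y z yx zx; rewrite mf ?inE ?Order.le_val.
move=> w /sf[y yx <-].
have ym : (cdim y <= m)%N by apply: leq_trans (leq_cdim yx) (valP x).
by exists (Sub y ym); rewrite ?SubK // -Order.le_val SubK.
Qed.

End Cellular.

Lemma cellular_eq_vertices d (K : cubicalType d) (V : finType) (f g : K -> network V) :
  cellular f -> cellular g -> (forall x, cdim x = 0 -> f x = g x) -> f =1 g.
Proof.
move=> cf cg fg x; apply: vertices_inj => P dP.
have half f1 g1 : cellular f1 -> cellular g1 -> (forall x, cdim x = 0 -> f1 x = g1 x) ->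
    (P <= f1 x -> P <= g1 x)%O.
  move=> cf1 cg1 fg1; have [_ sf] := cf1 x; case/sf => y yx fy.
  rewrite -fy fg1; first exact: cellular_homo.
  by rewrite -(cellular_cdim y cf1) fy.
by apply/idP/idP; apply: half => // y y0; rewrite fg.
Qed.

Section CubeCells.
Local Open Scope order_scope.
Variable k : nat.
Implicit Types (x : {ffun 'I_k -> bool}) (i j : 'I_k).

Definition corner x : cube k := [ffun i => Some (x i)].
Definition side x i : cube k := [ffun j => if j == i then None else Some (x j)].
Definition flip x i : {ffun 'I_k -> bool} := [ffun j => (j == i) (+) x j].

Lemma cdim_corner x : cdim (corner x) = 0.
Proof. by apply/eqP; rewrite cards_eq0; apply/eqP/setP => i; rewrite !inE ffunE. Qed.

Lemma cdim_side x i : cdim (side x i) = 1.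
Proof.
apply/eqP/cards1P; exists i; apply/setP => j; rewrite !inE ffunE.
by case: (j == i).
Qed.

Lemma corner_inj : injective corner.
Proof. by move=> x y /ffunP xy; apply/ffunP => i; have := xy i; rewrite !ffunE => -[]. Qed.

Lemma cdim0_corner (c : cube k) : cdim c = 0 -> exists x, c = corner x.
Proof.
move/eqP; rewrite cards_eq0 => /eqP/setP c0; exists [ffun i => c i == Some true].
by apply/ffunP => i; have := c0 i; rewrite !inE !ffunE; case: (c i) => [[]|].
Qed.

Lemma corner_side x i : corner x <= side x i.
Proof. by apply/cubeP => j; rewrite !ffunE; case: eqP; [left|right]. Qed.

Lemma flip_side x i : corner (flip x i) <= side x i.
Proof. by apply/cubeP => j; rewrite !ffunE; case: eqP; [left|right]. Qed.

Lemma flipK x i : flip (flip x i) i = x.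
Proof. by apply/ffunP => j; rewrite !ffunE addbA addbb. Qed.

Lemma flipC x i j : flip (flip x i) j = flip (flip x j) i.
Proof. by apply/ffunP => l; rewrite !ffunE addbCA. Qed.

Lemma flip_ind (P : {ffun 'I_k -> bool} -> Prop) :
  P [ffun=> false] -> (forall x i, x i = false -> P x -> P (flip x i)) -> forall x, P x.
Proof.
move=> P0 PS x; have [m] := ubnP #|[set i | x i]|; elim: m x => // m IH x.
have [/cards0_eq x0 _|/card_gt0P[i]] := posnP #|[set i | x i]|.
  suff -> : x = [ffun=> false] by [].
  by apply/ffunP => i; have := in_set0 i; rewrite -x0 inE ffunE.
rewrite inE => xi; rewrite (cardsD1 i) inE xi => xm.
rewrite -(flipK x i); apply: PS; first by rewrite ffunE eqxx xi.
apply: IH; move: xm; rewrite add1n ltnS; apply: leq_trans; rewrite ltnS subset_leq_card //.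
by apply/subsetP => j; rewrite !inE ffunE; have [->|] := eqVneq; rewrite ?xi.
Qed.

Fact corner_skeleton x : (cdim (corner x) <= 1)%N. Proof. by rewrite cdim_corner. Qed.
Fact side_skeleton x i : (cdim (side x i) <= 1)%N. Proof. by rewrite cdim_side. Qed.

Definition skel_corner x : skeleton 1 (cube k) := Sub (corner x) (corner_skeleton x).
Definition skel_side x i : skeleton 1 (cube k) := Sub (side x i) (side_skeleton x i).

End CubeCells.

(** * Filling the 1-skeleton of a cube *)

Lemma eq_resolve (V : finType) (N : prenetwork V) c c' :
  c =1 c' -> resolve N c = resolve N c'.
Proof.
move=> cc; apply: prenetwork_eq => x.
- by rewrite /pverts /= !inE cc.
- by apply/in_resolve_edges/in_resolve_edges => -[|[b [v [cb ->]]]];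
    [left|right; exists b, v; rewrite -cc|left|right; exists b, v; rewrite cc].
by rewrite /prmap /= !ffunE cc.
Qed.

Section Filling.
Local Open Scope order_scope.
Variables (V : finType) (k : nat) (f : skeleton 1 (cube k) -> network V).
Hypotheses (finj : injective f) (cf : cellular f).
Implicit Types (x y : {ffun 'I_k -> bool}) (i j : 'I_k).

Let o : {ffun 'I_k -> bool} := [ffun=> false].
Let F x : {set {set V}} := pedges (val (f (skel_corner x))).

Lemma filling_dim0 x : network_dim (f (skel_corner x)) = 0.
Proof.
rewrite -[LHS]/(cdim _) (cellular_cdim _ cf) -[LHS]/(cdim (corner x)).
exact: cdim_corner.
Qed.

Lemma filling_tree x : is_tree setT (F x).
Proof.
have /eqP/dim0P <- := filling_dim0 x.
by case/and3P: (valP (f (skel_corner x))).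
Qed.

Lemma filling_inj : injective F.
Proof.
move=> x y; have /eqP/dim0P vx := filling_dim0 x; have /eqP/dim0P vy := filling_dim0 y.
by move/(vertex_inj vx vy)/finj/(congr1 val)/corner_inj.
Qed.

Lemma filling_slide x i : exists b u v, slide b u v (F x) (F (flip x i)).
Proof.
apply: (@edge_cell_slide _ (f (skel_side x i))); try exact: filling_dim0.
- by rewrite -[LHS]/(cdim _) (cellular_cdim _ cf) -[LHS]/(cdim (side x i)) cdim_side.
- by apply: cellular_homo => //; rewrite -Order.le_val !SubK corner_side.
- by apply: cellular_homo => //; rewrite -Order.le_val !SubK flip_side.
move/finj/(congr1 val)/corner_inj/ffunP/(_ i); rewrite ffunE eqxx.
by case: (x i).
Qed.

Section Directions.
Variables (b u v : 'I_k -> V).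
Hypothesis slide_o : forall i, slide (b i) (u i) (v i) (F o) (F (flip o i)).

Lemma filling_square x i j : i != j -> x i = false -> x j = false ->
  slide (b i) (u i) (v i) (F x) (F (flip x i)) ->
  slide (b j) (u j) (v j) (F x) (F (flip x j)) ->
  [/\ slide (b i) (u i) (v i) (F (flip x j)) (F (flip (flip x j) i)),
    b i <> b j & b j \notin [set u i; v i]].
Proof.
move=> nij xi xj si sj; have ac : acyclic (F x) by case/and3P: (filling_tree x).
have [] // := slide_square_commute (E3 := F (flip (flip x j) i)) ac si sj.
- by rewrite flipC; exact: filling_slide.
- exact: filling_slide.
- by move/filling_inj/ffunP/(_ i); rewrite !ffunE eqxx xi (negbTE nij).
- by move/filling_inj/ffunP/(_ i); rewrite !ffunE eqxx xi (negbTE nij).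
Qed.

(** The slide in direction [i] is the same at all corners, by induction on the
    distance to the origin: each step crosses a square. *)
Lemma filling_up x i : x i = false -> slide (b i) (u i) (v i) (F x) (F (flip x i)).
Proof.
elim/flip_ind: x i => [|x j xj IH] i; first by move=> _; exact: slide_o.
rewrite ffunE; have [->|nij] /= := eqVneq i j; first by rewrite xj.
move=> xi; have [] // := filling_square nij xi xj (IH _ xi) (IH _ xj).
Qed.

Lemma filling_disjoint i j : i != j -> b i <> b j /\ b j \notin [set u i; v i].
Proof.
move=> nij; have [] // := filling_square nij _ _ (slide_o i) (slide_o j); rewrite ?ffunE //.
Qed.

Lemma filling_stub i j : b j \notin [set u i; v i].
Proof.
have [->|nij] := eqVneq i j; last by case: (filling_disjoint nij).
by have [_ /eqP ? /eqP ?] := slide_neq (slide_o j); rewrite !inE; apply/norP; split.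
Qed.

Lemma filling_b_inj : injective b.
Proof.
by move=> i j bij; have [//|/filling_disjoint[]] := eqVneq i j.
Qed.

(** The base from which [b i] hangs at the corner [x]. *)
Let att x i := if x i then v i else u i.
Let L := [set b i | i : 'I_k].
Let E0 := [set e in F o | [disjoint e & L]].

Lemma filling_at x i :
  slide (b i) (att x i) (att (flip x i) i) (F x) (F (flip x i)).
Proof.
rewrite /att ffunE eqxx /=; case xi: (x i) => /=; last exact: filling_up.
apply: slide_sym; have := @filling_up (flip x i) i; rewrite flipK; apply.
by rewrite ffunE eqxx xi.
Qed.

(** At every corner the [b i] are leaves with known bases, and crossing a side
    of the cube changes no edge away from them. *)
Lemma filling_edges x e :
  (e \in F x) <-> (e \in E0 \/ exists i, e = [set att x i; b i]).
Proof.
have keep : [disjoint e & L] -> (e \in F x) = (e \in F o).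
  move=> eL; elim/flip_ind: x => // x i xi <-; apply: (slide_keep (filling_up xi)).
  by apply: contraTN eL => be; apply/pred0Pn; exists (b i); rewrite /= be imset_f.
have [eL|] := boolP [disjoint e & L].
  rewrite keep // inE eL andbT; split=> [|[//|[i ei]]]; first by left.
  by move/pred0P: eL => /(_ (b i)); rewrite /= ei set22 imset_f.
move=> eL; rewrite inE (negbTE eL) andbF; case/pred0Pn: eL => z /= /andP[ze /imsetP[i _ zi]].
split=> [eF|[//|[j ->]]]; last exact: slide_stub (filling_at x j).
right; exists i; have [_ /eqP/cards2P[y [w [nyw eyw]]]] := tree_edge (filling_tree x) eF.
subst z; move: ze eF; rewrite eyw !inE => /orP[]/eqP <-.
  by rewrite setUC => /(slide_leaf (filling_at x i)) ->.
by move/(slide_leaf (filling_at x i)) ->.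
Qed.

Let idx (t : V) : option 'I_k := [pick i | b i == t].

Lemma idxP t : match idx t with Some i => t = b i | None => t \notin L end.
Proof.
rewrite /idx; case: pickP => [i /eqP->//|nb].
by apply/imsetP => -[i _ ti]; have := nb i; rewrite ti eqxx.
Qed.

Lemma idx_b i : idx (b i) = Some i.
Proof.
have := idxP (b i); case: (idx _) => [j /filling_b_inj->//|].
by rewrite imset_f.
Qed.

Lemma filling_stubL i : (u i \notin L) * (v i \notin L).
Proof.
split; apply/imsetP => -[j _ h]; have := filling_stub i j; rewrite -h !inE eqxx ?orbT //.
Qed.

(** The cell that fills the cube: the leaves [b i] are detached and free to
    hang from either end of [{u i, v i}]. *)
Let top : prenetwork V :=
  (setT :\: L, E0, [ffun t => omap (fun i => [set u i; v i]) (idx t)]).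

Hypothesis k_gt0 : (0 < k)%N.

Lemma is_network_top : is_network top.
Proof.
have axis i : [set u i; v i] \in E0.
  rewrite inE [_ \in _](slide_axis (slide_o i)) /=; apply/pred0P => z /=.
  rewrite !inE; apply/negP => /andP[/orP[]/eqP->].
    by rewrite (negbTE (filling_stubL i).1).
  by rewrite (negbTE (filling_stubL i).2).
apply/and3P; split.
- pose i := Ordinal k_gt0; have [/eqP nuv _ _] := slide_neq (slide_o i).
  have -> : 2 = #|[set u i; v i]| by rewrite cards2 nuv.
  apply/subset_leq_card/subsetP => z; rewrite !inE andbT.
  by case/orP=> /eqP->; rewrite filling_stubL.
- pose base t := if idx t is Some i then u i else t.
  apply: (tree_prune (base := base) (filling_tree o)); rewrite /base.
  + by move=> _ /imsetP[i _ ->]; rewrite idx_b filling_stubL.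
  + by move=> _ /imsetP[i _ ->] z; rewrite idx_b => /(slide_leaf (slide_o i)).
apply/forallP => t; rewrite /prmap /= ffunE /pverts /pedges /= !inE andbT.
by have := idxP t; case: (idx t) => [i ->|] //=; rewrite axis imset_f.
Qed.

Let N := Network is_network_top.

(** The face [c] of the cube attaches [b i] according to the [i]-th coordinate
    of [c], and leaves it free when this coordinate is the whole interval. *)
Let ch (c : cube k) (t : V) : option V :=
  obind (fun i => omap (fun s : bool => if s then v i else u i) (c i)) (idx t).

Lemma ch_choice c : choice_of (val N) (ch c).
Proof.
move=> t z; rewrite /ch /endpoint /prmap /= ffunE; case: (idx t) => [i|] //=.
by case: (c i) => [[]|] //= [<-]; rewrite !inE eqxx ?orbT.
Qed.

Lemma filling_top : exists g : cube k -> network V, forall c,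
  val (g c) = resolve (val N) (ch c) /\ g c <= N.
Proof.
have ex c : exists M : network V, val M = resolve (val N) (ch c) /\ M <= N.
  by have [M vM leM] := resolve_ex (@ch_choice c); exists M.
exact: fin_all_exists ex.
Qed.

Lemma filling_extension : exists g, cellular_extension f g.
Proof.
have [g gP] := filling_top; exists g.
have mg : {mono g : c c' / c <= c'}.
  move=> c c'; apply/(resolve_le (@ch_choice c) (@ch_choice c') (gP c).1 (gP c').1)/cubeP => h.
    move=> i; have := h (b i); rewrite /ch idx_b /=.
    have [nuv _ _] := slide_neq (slide_o i).
    by case: (c i) (c' i) => [[]|] [[]|] //=; intuition congruence.
  move=> y; rewrite /ch; case: (idx y) => [i|] /=; last by left.
  by case: (h i) => ->; [left|right].
have cg : cellular g.
  move=> x; split=> [y z _ _|w wx]; first exact: mg.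
  have /le_resolve[c chc vw] := le_trans wx (gP x).2.
  pose y : cube k := [ffun i => omap (fun z => z == v i) (c (b i))].
  suff wy : g y = w by exists y; rewrite -?mg wy.
  apply: val_inj; rewrite (gP y).1 vw; apply: eq_resolve => t.
  have := chc t; rewrite /endpoint /prmap /= ffunE /ch; have := idxP t.
  case: (idx t) => [i ->|_] /=; last by case: (c t) => // z /(_ z erefl).
  rewrite ffunE; case: (c (b i)) => [z|] //= /(_ z erefl).
  by rewrite !inE; case: (eqVneq z (v i)) => [->|_] //; rewrite orbF => /eqP->.
(* A cell is determined by its vertices, so only corners need be compared. *)
split=> // x.
suff : g \o val =1 f by apply.
apply: (cellular_eq_vertices (cellular_skeleton cg) cf) => y y0.
have [z yz] := cdim0_corner (y0 : cdim (val y) = 0).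
have -> : y = skel_corner z by apply: val_inj; rewrite SubK.
rewrite SubK; apply: vertex_inj.
- rewrite (gP _).1; apply/setP => t; rewrite /resolve /pverts /= !inE andbT.
  have := idxP t; rewrite /ch; case: (idx t) => [i _|-> //] /=.
  by rewrite ffunE orbT.
- by apply/dim0P/eqP; exact: filling_dim0.
apply/setP => e; rewrite (gP _).1; apply/in_resolve_edges/idP => [eE|/filling_edges].
  apply/filling_edges; case: eE => [|[t [w [tw ->]]]]; [by left|right].
  move: tw; rewrite /ch; have := idxP t; case: (idx t) => [i ->|] //=.
  by rewrite ffunE => -[<-]; exists i.
case=> [|[i ->]]; [by left|right].
by exists (b i), (att z i); rewrite /ch idx_b /= ffunE.
Qed.

End Directions.
End Filling.

Theorem lemma4p3 (n : nat) (hn : 3 <= n) : cubical_flag (realignment_complex n).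
Proof.
move=> k f k2 finj cf.
have [b /fin_all_exists[u /fin_all_exists[v slide_o]]] :=
  fin_all_exists (filling_slide finj cf [ffun=> false]).
have [g [cg gf]] := filling_extension finj cf slide_o (ltnW k2).
exists g => // g' [cg' g'f]; apply: cellular_eq_vertices => // c c0.
by have [x ->] := cdim0_corner c0; have := gf (skel_corner x); rewrite -g'f SubK.
Qed.
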